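(* In the finite one-way scheme with two groups (see context), let $g$ be the marginal dispersion and let $\sim$ be the equivalence relation on $T$ generated by $s\sim s+(\mu_1-\mu_2)^2/4$ for $s\in S$ and $\mu_1,\mu_2\in M$. Let $r=(r_{\omega_1},r_{\omega_2})$ be a pair of maps $T\to T$. The recalibration $r\circ g$ is natural over $\mathsf\Omega_{\mathrm{full}}$ if and only if $r_{\omega_2}$ is constant on each class of $\sim$ and $r_{\omega_1}=r_{\omega_2}$ on $S$. Furthermore: (1) there is a natural recalibration (over $\mathsf\Omega_{\mathrm{full}}$) with $r_{\omega_2}$ not constant if and only if $\sim$ has at least two classes; (2) if $|M|\ge2$ then no natural recalibration (over $\mathsf\Omega_{\mathrm{full}}$) has $r_{\omega_2}$ injective; (3) over $\mathsf\Omega_{\mathrm{arr}}$ the recalibration $r\circ g$ is natural if and only if $r_{\omega_1}=r_{\omega_2}$ on $S$.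
   Context: $\mathsf\Omega_{\mathrm{full}}$ is the full subcategory of finite sets on the two objects $\omega_1=\{*\}$ and $\omega_2=\{1,2\}$; its non-identity morphisms are the merge $p:\omega_2\to\omega_1$, the selections $i_1,i_2:\omega_1\to\omega_2$ ($i_k( * )=k$), the swap $\sigma$ of $\omega_2$, and the constants $c_k=i_kp$. $\mathsf\Omega_{\mathrm{arr}}$ is the category with the same two objects and with $p$ as the only non-identity morphism. $M\subset\mathbb Q$ (means) and $S\subset\mathbb Q_{>0}$ (dispersions) are finite non-empty sets; $\Theta(\omega)=M^\omega\times S$ with $\Theta(\psi)(\mu',s)=(\mu'\circ\psi,s)$, so $\Theta(p)(\mu,s)=((\mu,\mu),s)$, $\Theta(i_k)((\mu_1,\mu_2),s)=(\mu_k,s)$ and $\Theta(\sigma)$ is the swap of the means. The marginal dispersion is $g_{\omega_1}(\mu,s)=s$, $g_{\omega_2}((\mu_1,\mu_2),s)=s+(\mu_1-\mu_2)^2/4$, with target constant at $T=g_{\omega_2}(\Theta(\omega_2))\supseteq S$. A recalibration of $g$ is a family $r\circ g=(r_{\omega_1}g_{\omega_1},r_{\omega_2}g_{\omega_2})$ with $r_{\omega_1},r_{\omega_2}:T\to T$ maps. A family of maps $f_\omega:\Theta(\omega)\to T$ is natural over a category $\mathsf Q$ with these objects if $f_\omega\circ\Theta(\psi)=f_{\omega'}$ for every $\psi:\omega\to\omega'$ in $\mathsf Q$. *)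

(* Defs.v *)
From Stdlib Require Export Relation_Operators.
From mathcomp Require Export all_boot all_order all_algebra finmap.
From mathcomp Require Export boolp.

Set Implicit Arguments.
Unset Strict Implicit.
Unset Printing Implicit Defensive.

Import Order.TTheory GRing.Theory Num.Theory.
Local Open Scope fset_scope.
Local Open Scope ring_scope.

Inductive obj := omega1 | omega2.

(* The point * of omega1 is ord0; the points 1, 2 of omega2 are ord0, ord_max. *)
Definition pts (w : obj) : finType :=
  match w with omega1 => 'I_1 | omega2 => 'I_2 end.

Definition id_map (w : obj) : {ffun pts w -> pts w} := [ffun x => x].

Definition comp_map (u v w : obj)
    (f : {ffun pts v -> pts w}) (h : {ffun pts u -> pts v}) :
    {ffun pts u -> pts w} := [ffun x => f (h x)].

(* Categories with objects omega1, omega2 whose morphisms are maps of finite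
   sets, i.e., wide subcategories of the full one. *)
Record category := Category {
  hom : forall w w' : obj, {ffun pts w -> pts w'} -> Prop;
  hom_id : forall w, hom (id_map w);
  hom_comp : forall u v w (f : {ffun pts v -> pts w})
      (h : {ffun pts u -> pts v}),
    hom f -> hom h -> hom (comp_map f h)
}.

Definition Omega_full : category :=
  @Category (fun _ _ _ => True) (fun _ => I) (fun _ _ _ _ _ _ _ => I).

Definition merge : {ffun pts omega2 -> pts omega1} := [ffun=> ord0].

Inductive arr_hom : forall w w' : obj, {ffun pts w -> pts w'} -> Prop :=
| arr_id (w : obj) : arr_hom (id_map w)
| arr_merge : arr_hom merge.

Lemma arr_hom_comp (u v w : obj) (f : {ffun pts v -> pts w})
    (h : {ffun pts u -> pts v}) :
  arr_hom f -> arr_hom h -> arr_hom (comp_map f h).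
Proof.
move=> Hf; case: Hf h => [a|] h Hh.
  suff -> : comp_map (id_map a) h = h by [].
  by apply/ffunP => x; rewrite !ffunE.
have dom2 a b (k : {ffun pts a -> pts b}) : arr_hom k -> b = omega2 ->
  a = omega2 by case.
have u2 := dom2 _ _ h Hh erefl; subst u.
suff -> : comp_map merge h = merge by exact: arr_merge.
by apply/ffunP => x; rewrite !ffunE.
Qed.

Definition Omega_arr : category := Category arr_id arr_hom_comp.

Section Scheme.
Variables M S : {fset rat}.

Definition Theta (w : obj) : finType := ({ffun pts w -> M} * S)%type.

Definition Theta_map (w w' : obj) (psi : {ffun pts w -> pts w'})
    (x : Theta w') : Theta w := ([ffun i => x.1 (psi i)], x.2).

Definition dispersion (w : obj) : Theta w -> rat :=
  match w with
  | omega1 => fun x => val x.2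
  | omega2 => fun x =>
      val x.2 + (val (x.1 ord0) - val (x.1 ord_max)) ^+ 2 / 4
  end.

Definition T : {fset rat} := [fset dispersion x | x in Theta omega2].

Lemma dispersion_in_T (w : obj) (x : Theta w) : dispersion x \in T.
Proof.
case: w x => x; last by apply/imfsetP; exists x.
apply/imfsetP; exists (Theta_map merge x) => //=.
by rewrite !ffunE subrr expr0n mul0r addr0.
Qed.

Lemma sub_S_T : M != fset0 -> {subset S <= T}.
Proof.
case/fset0Pn => m mM s sS.
exact: (@dispersion_in_T omega1 ([ffun=> [` mM]], [` sS])).
Qed.

Definition g (w : obj) (x : Theta w) : T := [` dispersion_in_T x].

Definition recalibration (r : obj -> T -> T) (w : obj) (x : Theta w) : T :=
  r w (g x).

Definition natural (Q : category) (f : forall w, Theta w -> T) : Prop :=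
  forall (w w' : obj) (psi : {ffun pts w -> pts w'}), hom Q psi ->
  forall x : Theta w', f w (Theta_map psi x) = f w' x.

Definition sim : T -> T -> Prop :=
  clos_refl_sym_trans T (fun t t' =>
    exists (s : S) (mu1 mu2 : M),
      val t = val s /\ val t' = val s + (val mu1 - val mu2) ^+ 2 / 4).

Definition sim_classes : {set {set T}} :=
  equivalence_partition (fun t t' => `[< sim t t' >]) [set: T].

Definition constant_on_classes (f : T -> T) : Prop :=
  forall C : {set T}, C \in sim_classes -> {in C &, forall t t', f t = f t'}.

Definition agree_on_S (f h : T -> T) : Prop :=
  forall t : T, val t \in S -> f t = h t.

Definition constant_map (f : T -> T) : Prop :=
  exists c : T, forall t, f t = c.

End Scheme.

(* Main.v *)
Require Import Defs.

Set Implicit Arguments.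
Unset Strict Implicit.
Unset Printing Implicit Defensive.

Import Order.TTheory GRing.Theory Num.Theory.
Local Open Scope fset_scope.
Local Open Scope ring_scope.

(** Every map of the scheme, whatever its effect on the means, leaves the
    dispersion coordinate of a parameter alone, and the marginal dispersion of
    any parameter [x] is equivalent to that coordinate: it equals [x.2] for one
    group, and is the target of a generating step out of [x.2] for two groups
    ([sim_dispersion]).  So if [r omega2] is constant on classes and agrees
    with [r omega1] on [S], then [r w (g x) = r omega2 x.2] for both objects;
    a family which depends only on the coordinate fixed by all maps is natural
    ([natural_full_of_constant]).

    Conversely, selecting the first group forgets the mean of the second: it
    sends both [(mu1, mu2, s)] and [(mu1, mu1, s)] to [(mu1, s)].  Naturality
    along this one arrow therefore identifies the values of [r omega2] at the
    two ends of each generating step ([natural_full_step]), hence on classes.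
    The merge, on the other hand, only produces equal means, where the marginal
    dispersion is [s] itself: naturality along it says exactly that [r omega1]
    and [r omega2] agree on [S] ([natural_merge]), and it is the only constraint
    over the arrow category.

    The remaining claims are read off from this description.  A function
    constant on classes can be non-constant exactly when two elements are
    inequivalent, the indicator of a class being a witness; and two distinct
    means produce a generating step between distinct elements of [T], which an
    injective map must separate. *)

(** * Classes of the equivalence *)

Section Classes.
Variables M S : {fset rat}.
Implicit Types t : T M S.

Lemma sim_equivalence :
  {in [set: T M S] & &, equivalence_rel (fun t t' => `[< sim t t' >])}.
Proof.
move=> x y z _ _ _; split; first by apply/asboolP; exact: rst_refl.
move=> /asboolP xy; apply/asboolP/asboolP => h; last exact: rst_trans xy h.
by apply: rst_trans h; apply: rst_sym.
Qed.

Lemma mem_pblock_sim t t' :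
  (t' \in pblock (sim_classes M S) t) = `[< sim t t' >].
Proof. by rewrite (pblock_equivalence_partition sim_equivalence) ?inE. Qed.

Lemma pblock_sim_classes t : pblock (sim_classes M S) t \in sim_classes M S.
Proof.
by rewrite pblock_mem // (cover_partition (equivalence_partitionP sim_equivalence)).
Qed.

Lemma sim_classesP (C : {set T M S}) t :
  C \in sim_classes M S -> t \in C -> C = pblock (sim_classes M S) t.
Proof.
move=> Cc tC; have [_ triv _] := and3P (equivalence_partitionP sim_equivalence).
by rewrite (def_pblock triv Cc tC).
Qed.

Lemma constant_on_classesP (f : T M S -> T M S) :
  constant_on_classes f <-> forall t t', sim t t' -> f t = f t'.
Proof.
split=> [fC t t' tt'|fsim C Cc t t' tC].
  apply: (fC _ (pblock_sim_classes t)); rewrite mem_pblock_sim; apply/asboolP=> //.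
  exact: rst_refl.
by rewrite (sim_classesP Cc tC) mem_pblock_sim => /asboolP /fsim.
Qed.

Lemma two_sim_classesP :
  (2 <= #|sim_classes M S|)%N <-> exists t t', ~ sim t t'.
Proof.
split=> [/card_gt1P [C [D [Cc Dc CD]]]|[t [t' tt']]].
  have [_ _ not0] := and3P (equivalence_partitionP sim_equivalence).
  have nonempty E : E \in sim_classes M S -> exists t, t \in E.
    by move=> Ec; apply/set0Pn; apply: contraNneq not0 => <-.
  have [[t tC] [t' t'D]] := (nonempty C Cc, nonempty D Dc).
  exists t, t' => tt'; case/eqP: CD.
  suff t'C : t' \in C by rewrite (sim_classesP Cc t'C) (sim_classesP Dc t'D).
  by rewrite (sim_classesP Cc tC) mem_pblock_sim; apply/asboolP.
apply/card_gt1P; exists (pblock (sim_classes M S) t).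
exists (pblock (sim_classes M S) t'); split; try exact: pblock_sim_classes.
apply/eqP => E; apply: tt'; apply/asboolP.
by rewrite -mem_pblock_sim E mem_pblock_sim; apply/asboolP; exact: rst_refl.
Qed.

End Classes.

(** * Naturality of recalibrations *)

Section Recalibration.
Variables M S : {fset rat}.
Hypothesis M_neq0 : M != fset0.
Implicit Types (r : obj -> T M S -> T M S) (s : S).

Definition base s : T M S := [` sub_S_T M_neq0 (valP s)].

Lemma g_one (x : Theta M S omega1) : g x = base x.2.
Proof. exact: val_inj. Qed.

Lemma g_merge (x : Theta M S omega1) : g (Theta_map merge x) = base x.2.
Proof. by apply: val_inj; rewrite /= !ffunE subrr expr0n mul0r addr0. Qed.

Lemma g_equal_means (m : M) s :
  g (([ffun=> m], s) : Theta M S omega2) = base s.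
Proof. by apply: val_inj; rewrite /= !ffunE subrr expr0n mul0r addr0. Qed.

Lemma sim_dispersion (w : obj) (x : Theta M S w) : sim (base x.2) (g x).
Proof.
case: w x => x; first by rewrite g_one; exact: rst_refl.
by apply: rst_step; exists x.2, (x.1 ord0), (x.1 ord_max).
Qed.

(** Naturality along a single arrow, the merge: the arguments at which it
    compares the two components of [r] are exactly the elements of [S], every
    one of which occurs because there is some mean. *)
Lemma natural_merge r :
  (forall x : Theta M S omega1,
     recalibration r (Theta_map merge x) = recalibration r x) <->
  agree_on_S (r omega1) (r omega2).
Proof.
split=> [nat_r t tS|agr x]; last first.
  by rewrite /recalibration g_merge g_one agr //=; exact: valP.
have /fset0Pn[m mM] := M_neq0.
have := nat_r ([ffun=> [` mM]], [` tS]).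
rewrite /recalibration g_merge g_one /=.
by have -> : base [` tS] = t by exact: val_inj.
Qed.

(** Both [(mu1, mu2, s)] and [(mu1, mu1, s)] select to [(mu1, s)], and the
    marginal dispersion of the second is [s]. *)
Lemma natural_full_step r : natural Omega_full (recalibration r) ->
  forall x : Theta M S omega2, r omega2 (base x.2) = r omega2 (g x).
Proof.
move=> nat_r [mu s].
pose sel : {ffun pts omega1 -> pts omega2} := [ffun=> ord0].
rewrite -[RHS]/(recalibration r (mu, s)) -(nat_r _ _ sel I).
rewrite -(g_equal_means (mu ord0)).
rewrite -[LHS]/(recalibration r (([ffun=> mu ord0], s) : Theta M S omega2)).
rewrite -(nat_r _ _ sel I); congr (recalibration r (_, _)).
by apply/ffunP => i; rewrite !ffunE.
Qed.

Lemma natural_full_sim r : natural Omega_full (recalibration r) ->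
  forall t t', sim t t' -> r omega2 t = r omega2 t'.
Proof.
move=> nat_r t t'; elim=> {t t'} [t t' [s [m1 [m2 [ts t's]]]]|//||].
- pose mu : {ffun pts omega2 -> M} := [ffun i => if i == ord0 then m1 else m2].
  have -> : t = base s by exact: val_inj.
  have -> : t' = g ((mu, s) : Theta M S omega2).
    by apply: val_inj; rewrite /= !ffunE.
  exact: (natural_full_step nat_r (mu, s)).
- by move=> t t' _ ->.
- by move=> t t' t'' _ -> _ ->.
Qed.

(** Along a class [r omega2 (g x)] may be replaced by [r omega2 x.2], which no
    map of the scheme can change. *)
Lemma natural_full_of_constant r :
  (forall t t', sim t t' -> r omega2 t = r omega2 t') ->
  agree_on_S (r omega1) (r omega2) -> natural Omega_full (recalibration r).
Proof.
move=> r_sim agr.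
have fE w (x : Theta M S w) : recalibration r x = r omega2 (base x.2).
  rewrite (r_sim _ _ (sim_dispersion x)); case: w x => // x.
  by rewrite /recalibration agr //=; exact: valP.
by move=> w w' psi _ x; rewrite !fE.
Qed.

Lemma natural_fullP r :
  natural Omega_full (recalibration r) <->
  constant_on_classes (r omega2) /\ agree_on_S (r omega1) (r omega2).
Proof.
rewrite constant_on_classesP.
split=> [nat_r|[]]; last exact: natural_full_of_constant.
split; first exact: natural_full_sim.
by apply/natural_merge => x; exact: nat_r.
Qed.

Lemma natural_arrP r :
  natural Omega_arr (recalibration r) <-> agree_on_S (r omega1) (r omega2).
Proof.
rewrite -natural_merge; split=> [nat_r x|nat_merge w w' psi].
  by apply: nat_r; exact: arr_merge.
case=> {w w' psi} [w|] x; last exact: nat_merge.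
congr (recalibration r _); case: x => mu s; congr (_, _).
by apply/ffunP => i; rewrite !ffunE.
Qed.

Lemma nonconstant_naturalP : S != fset0 ->
  (exists r, natural Omega_full (recalibration r) /\
             ~ constant_map (r omega2)) <->
  (2 <= #|sim_classes M S|)%N.
Proof.
move=> /fset0Pn[s sS]; rewrite two_sim_classesP.
split=> [[r [nat_r nconst]]|[t [t' tt']]].
  apply: contrapT => all_sim; apply: nconst.
  exists (r omega2 (base [` sS])) => t; apply: natural_full_sim => //.
  by apply: contrapT => ?; apply: all_sim; exists t, (base [` sS]).
(* The indicator of the class of t, with t and t' as its two values. *)
exists (fun _ u => if `[< sim t u >] then t else t'); split.
  apply: natural_full_of_constant => // u u' uu'.
  suff -> : `[< sim t u >] = `[< sim t u' >] by [].
  apply/asboolP/asboolP => h; first exact: rst_trans h uu'.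
  by apply: rst_trans h _; exact: rst_sym.
case=> c const_c; apply: tt'; have := const_c t'; rewrite -(const_c t).
case: asboolP => // _; case: asboolP => [_ ->|[]]; exact: rst_refl.
Qed.

(** A step from [s] between two different means moves strictly, as the square
    added to [s] is nonzero, while [r omega2] takes equal values at its ends. *)
Lemma natural_not_injective r : S != fset0 -> (2 <= #|` M|)%N ->
  natural Omega_full (recalibration r) -> ~ injective (r omega2).
Proof.
move=> /fset0Pn[s sS]; rewrite cardfE.
move=> /card_gt1P [m1 [m2 [_ _ m12]]] nat_r inj_r.
pose mu : {ffun pts omega2 -> M} := [ffun i => if i == ord0 then m1 else m2].
have /inj_r/(congr1 val) := natural_full_step nat_r (mu, [` sS]).
rewrite /= !ffunE /= => /eqP.
rewrite -subr_eq0 opprD addNKr oppr_eq0 mulf_eq0 invr_eq0 pnatr_eq0 orbF.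
by rewrite sqrf_eq0 subr_eq0 (inj_eq val_inj) (negPf m12).
Qed.

End Recalibration.

(** * The characterisation *)

Theorem proposition6p9 (M S : {fset rat}) (M_neq0 : M != fset0)
    (S_neq0 : S != fset0) (S_gt0 : forall s : rat, s \in S -> 0 < s) :
  [/\ forall r : obj -> T M S -> T M S,
        natural Omega_full (recalibration r) <->
        constant_on_classes (r omega2) /\ agree_on_S (r omega1) (r omega2),
      (exists r : obj -> T M S -> T M S,
         natural Omega_full (recalibration r) /\ ~ constant_map (r omega2)) <->
      (2 <= #|sim_classes M S|)%N,
      (2 <= #|` M|)%N ->
      ~ (exists r : obj -> T M S -> T M S,
           natural Omega_full (recalibration r) /\ injective (r omega2))
    & forall r : obj -> T M S -> T M S,
        natural Omega_arr (recalibration r) <->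
        agree_on_S (r omega1) (r omega2)].
Proof.
split.
- exact: natural_fullP.
- exact: nonconstant_naturalP.
- by move=> M2 [r [nat_r]]; exact: natural_not_injective.
- exact: natural_arrP.
Qed.
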